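(* For every integer $n\geq 3$, the $(n-1)$-th Lucas number $\ell_{n-1}$ equals the number of perfect matchings of the Cartesian product graph $P_2\times T_n$.
   Context: $P_2$ is the path with two vertices. $T_n$ is the caterpillar with vertex set $\{1,\dots,n\}$ and edges $\{1,3\}$, $\{2,3\}$, and $\{i,i+1\}$ for $3\leq i\leq n-1$ (a path $2,3,4,\dots,n$ with an extra pendant vertex $1$ attached to vertex $3$). $P_2\times T_n$ is the Cartesian product of graphs. Lucas numbers: $\ell_1=1,\ell_2=3$, $\ell_k=\ell_{k-1}+\ell_{k-2}$. *)

(* Defs.v *)
From mathcomp Require Import all_boot.

Set Implicit Arguments.
Unset Strict Implicit.
Unset Printing Implicit Defensive.

Record sgraph := SGraph {
  vertex :> finType;
  adj : rel vertex;
  adj_sym : symmetric adj;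
  adj_irrefl : irreflexive adj }.

Definition edges (G : sgraph) : {set {set G}} :=
  [set e : {set G} | [exists x : G, exists y : G, adj x y && (e == [set x; y])]].

Definition perfect_matching (G : sgraph) (M : {set {set G}}) : bool :=
  (M \subset edges G) && [forall v : G, #|[set e in M | v \in e]| == 1].

Definition num_perfect_matchings (G : sgraph) : nat :=
  #|[set M : {set {set G}} | perfect_matching M]|.

Section CartesianProduct.
Variables G H : sgraph.

Definition cart_adj : rel (G * H)%type := fun p q =>
  (p.1 == q.1) && adj p.2 q.2 || (p.2 == q.2) && adj p.1 q.1.

Lemma cart_adj_sym : symmetric cart_adj.
Proof.
move=> [a b] [c d]; rewrite /cart_adj /=.
by rewrite eq_sym (eq_sym b) (adj_sym b) (adj_sym a).
Qed.

Lemma cart_adj_irrefl : irreflexive cart_adj.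
Proof. by move=> [a b]; rewrite /cart_adj /= !adj_irrefl !andbF. Qed.

Definition cart_prod : sgraph := SGraph cart_adj_sym cart_adj_irrefl.

End CartesianProduct.

Section PathGraph.
Variable n : nat.

Definition path_adj : rel 'I_n := fun i j => (i.+1 == j) || (j.+1 == i).

Lemma path_adj_sym : symmetric path_adj.
Proof. by move=> i j; rewrite /path_adj orbC. Qed.

Lemma path_adj_irrefl : irreflexive path_adj.
Proof. by move=> i; rewrite /path_adj gtn_eqF. Qed.

Definition path_graph : sgraph := SGraph path_adj_sym path_adj_irrefl.

End PathGraph.

(* The edges {a, b}, a < b, of the caterpillar in terms of the labels 1, 2, ... *)
Definition caterpillar_edge (a b : nat) : bool :=
  [|| (a == 1) && (b == 3), (a == 2) && (b == 3) | (3 <= a) && (b == a.+1)].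

Section Caterpillar.
Variable n : nat.

(* The ordinal i : 'I_n stands for the vertex with label i.+1 in {1, ..., n}. *)
Definition caterpillar_adj : rel 'I_n := fun i j =>
  caterpillar_edge i.+1 j.+1 || caterpillar_edge j.+1 i.+1.

Lemma caterpillar_adj_sym : symmetric caterpillar_adj.
Proof. by move=> i j; rewrite /caterpillar_adj orbC. Qed.

Lemma caterpillar_adj_irrefl : irreflexive caterpillar_adj.
Proof.
move=> i; rewrite /caterpillar_adj orbb /caterpillar_edge.
by case: i => [[|[|m]] im] //=; rewrite ltn_eqF ?andbF.
Qed.

Definition caterpillar : sgraph :=
  SGraph caterpillar_adj_sym caterpillar_adj_irrefl.

End Caterpillar.

(* The value 2 at index 0 is the one forced by the recurrence from the values
   1 and 3 at indices 1 and 2. *)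
Fixpoint lucas (k : nat) : nat :=
  match k with
  | 0 => 2
  | 1 => 1
  | (k'.+1 as k1).+1 => lucas k1 + lucas k'
  end.

(* Main.v *)
Require Import Defs.
From mathcomp Require Import all_boot.
From mathcomp Require Import zify.

(** A perfect matching is an exact cover of the vertices by edges, so sorting
    the matchings by the edge at a fixed vertex expands their number as a sum.
    Let [v] be a leaf of [T] with neighbour [w].  A perfect matching of
    [P_2 x T] either matches the two copies of [v] with each other, or matches
    each of them with the copy of [w] in its own layer.  Hence the number [N T]
    of these matchings satisfies [N T = N (T - v) + N (T - v - w)].  Stripping
    the last vertex of the caterpillar gives the Lucas recurrence, and the
    vertices 1, 2, 3 give the initial values. *)

Set Implicit Arguments.
Unset Strict Implicit.
Unset Printing Implicit Defensive.

Section ExactCovers.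
Variable T : finType.
Implicit Types (A B : {set T}) (E P : {set {set T}}).

Lemma partition_cardE P A :
  partition P A =
  (set0 \notin P) && [forall x, #|[set B in P | x \in B]| == (x \in A)].
Proof.
have coverE x : (x \in cover P) = (0 < #|[set B in P | x \in B]|).
  apply/bigcupP/card_gt0P => [[B PB Bx]|[B /setIdP[PB Bx]]].
    by exists B; rewrite inE PB.
  by exists B.
apply/idP/andP => [partP|[P0 /forallP cardP]].
  split; first by rewrite (partition0 partP).
  apply/forallP => x; rewrite -(cover_partition partP) coverE.
  case: posnP => [-> //|card_gt0].
  rewrite eqn_leq card_gt0 andbT; apply/card_le1_eqP => B C.
  move=> /setIdP[PB Bx] /setIdP[PC Cx]; have tiP := partition_trivIset partP.
  by rewrite -(def_pblock tiP PB Bx) -(def_pblock tiP PC Cx).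
apply/and3P; split=> //.
  by apply/eqP/setP => x; rewrite coverE (eqP (cardP x)) lt0b.
apply/trivIsetP => B C PB PC; apply: contraR => /pred0Pn[x /andP[Bx Cx]].
have /card_le1_eqP inj : #|[set B in P | x \in B]| <= 1.
  by rewrite (eqP (cardP x)) leq_b1.
by apply/eqP/inj; rewrite inE ?PB ?PC.
Qed.

Definition exact_covers E A : {set {set {set T}}} :=
  [set P | partition P A & P \subset E].

Lemma exact_covers_set0 E : exact_covers E set0 = [set set0].
Proof.
apply/setP => P; rewrite !inE partition_set0 andb_idr // => /eqP->.
exact: sub0set.
Qed.

Lemma card_exact_covers_block E A B :
  B \in E -> B != set0 -> B \subset A ->
  #|[set P in exact_covers E A | B \in P]| = #|exact_covers E (A :\: B)|.
Proof.
move=> EB B0 sBA.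
have notinB P : P \in exact_covers E (A :\: B) -> B \notin P.
  move=> /setIdP[partP _]; apply: contra B0 => /(partitionS partP).
  by rewrite subsetD -setI_eq0 setIid => /andP[].
rewrite -(card_in_imset (f := setU [set B]) (D := exact_covers E (A :\: B))).
  apply: eq_card => P; apply/idP/imsetP => [|[Q cQ ->]].
    rewrite !inE => /andP[/andP[partP sPE] PB]; exists (P :\ B).
      by rewrite inE partitionD1 // (subset_trans (subD1set _ _)).
    by rewrite setD1K.
  move: (cQ); rewrite !inE eqxx andbT => /andP[partQ sQE].
  rewrite subUset sub1set EB sQE !andbT.
  have defA : B :|: A :\: B = A by rewrite -{1}(setIidPr sBA) setID.
  rewrite -{}defA partitionU1 //.
  by rewrite -setI_eq0 setDE setICA setICr setI0.
move=> P Q /notinB PB /notinB QB eqPQ.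
by rewrite -(setU1K PB) -(setU1K QB) eqPQ.
Qed.

Lemma card_exact_covers_expand E A x : x \in A ->
  #|exact_covers E A| =
  \sum_(B in E | (x \in B) && (B \subset A)) #|exact_covers E (A :\: B)|.
Proof.
move=> Ax; rewrite -sum1_card.
rewrite (partition_big (fun P => pblock P x)
           (fun B => (B \in E) && ((x \in B) && (B \subset A)))) /=; last first.
  move=> P /setIdP[partP sPE].
  have xP : x \in cover P by rewrite (cover_partition partP).
  have PB := pblock_mem xP.
  by rewrite (subsetP sPE) // mem_pblock xP (partitionS partP).
apply: eq_bigr => B /and3P[EB Bx sBA].
rewrite -card_exact_covers_block //; last by apply/set0Pn; exists x.
rewrite -sum1_card; apply: eq_bigl => P; rewrite 2!inE.
case: (boolP (partition P A)) => //= partP; congr (_ && _).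
have xP : x \in cover P by rewrite (cover_partition partP).
apply/eqP/idP => [<-|PB]; first exact: pblock_mem.
exact: def_pblock (partition_trivIset partP) PB Bx.
Qed.

End ExactCovers.

Section PerfectMatchings.
Variable G : sgraph.
Implicit Types (A : {set G}) (u v w : G).

Lemma adj_neq v w : adj v w -> v != w.
Proof. by apply: contraTneq => ->; rewrite adj_irrefl. Qed.

Definition neighbors A v : {set G} := [set u in A | adj v u].

Lemma neighbors_set1 u v :
  neighbors [set u] v = if adj v u then [set u] else set0.
Proof.
by apply/setP => x; case: ifP => vu; rewrite !inE; case: eqVneq => [->|].
Qed.

Lemma neighborsU1 A u v :
  neighbors (u |: A) v =
  if adj v u then u |: neighbors A v else neighbors A v.
Proof.
by apply/setP => x; case: ifP => vu; rewrite !inE;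
  case: eqVneq => [->|//]; rewrite vu ?andbF.
Qed.

Lemma neighborsD1 A u v : neighbors (A :\ u) v = neighbors A v :\ u.
Proof. by apply/setP => x; rewrite !inE andbA. Qed.

Lemma edgesP (e : {set G}) :
  reflect (exists v w, adj v w /\ e = [set v; w]) (e \in edges G).
Proof.
rewrite inE; apply: (iffP existsP) => [[v /existsP[w /andP[vw /eqP->]]]|].
  by exists v, w.
by move=> [v [w [vw ->]]]; exists v; apply/existsP; exists w; rewrite vw eqxx.
Qed.

Lemma set0_notin_edges : set0 \notin edges G.
Proof.
by apply/edgesP => -[v [w [_ /setP/(_ v)]]]; rewrite !inE eqxx.
Qed.

Definition num_perfect_matchings_on A : nat := #|exact_covers (edges G) A|.

Lemma num_perfect_matchings_onT :
  num_perfect_matchings_on setT = num_perfect_matchings G.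
Proof.
apply: eq_card => M; rewrite !inE andbC partition_cardE /perfect_matching.
case: (boolP (M \subset edges G)) => //= sM.
rewrite (contra (subsetP sM set0) set0_notin_edges) /=.
by apply: eq_forallb => v; rewrite inE.
Qed.

Lemma num_perfect_matchings_on0 : num_perfect_matchings_on set0 = 1.
Proof. by rewrite /num_perfect_matchings_on exact_covers_set0 cards1. Qed.

Lemma num_perfect_matchings_on_expand A v : v \in A ->
  num_perfect_matchings_on A =
  \sum_(w in neighbors A v) num_perfect_matchings_on (A :\ v :\ w).
Proof.
move=> Av; rewrite {1}/num_perfect_matchings_on (card_exact_covers_expand _ Av).
under [RHS]eq_bigr => w _ do rewrite setDDl.
rewrite -(big_imset (h := fun w => [set v; w])
            (fun e => num_perfect_matchings_on (A :\: e))) /=; last first.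
  move=> w w'; rewrite inE => /andP[_ /adj_neq neq_vw] _ /setP/(_ w).
  by rewrite !inE eqxx orbT [w == v]eq_sym (negPf neq_vw) => /esym/eqP.
apply: eq_bigl => e; apply/and3P/imsetP => [[/edgesP[x [y [xy ->]]]]|[w]].
  rewrite subUset !sub1set => /set2P[]-> /andP[Ax Ay].
    by exists y; rewrite ?inE ?Ay.
  by exists x; rewrite 1?setUC // inE Ax adj_sym.
rewrite inE => /andP[Aw vw] ->; rewrite set21 subUset !sub1set Av Aw.
by split=> //; apply/edgesP; exists v, w.
Qed.

Lemma num_perfect_matchings_on_deg1 A v w :
  v \in A -> neighbors A v = [set w] ->
  num_perfect_matchings_on A = num_perfect_matchings_on (A :\ v :\ w).
Proof. by move=> /num_perfect_matchings_on_expand-> ->; rewrite big_set1. Qed.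

Lemma num_perfect_matchings_on_deg2 A v w w' :
  v \in A -> w != w' -> neighbors A v = [set w; w'] ->
  num_perfect_matchings_on A =
  num_perfect_matchings_on (A :\ v :\ w) +
  num_perfect_matchings_on (A :\ v :\ w').
Proof.
move=> /num_perfect_matchings_on_expand-> neq_ww' ->.
by rewrite big_setU1 ?inE //= big_set1.
Qed.

End PerfectMatchings.

Section Prism.
Variable H : sgraph.
Implicit Types (S : {set H}) (u v w : H).

Let P2 := path_graph 2.
Let G := cart_prod P2 H.

Definition prism S : {set G} := setX setT S.

Lemma adj_prism (i j : P2) u v :
  adj ((i, u) : G) (j, v) = if i == j then adj u v else u == v.
Proof.
case: i j => [[|[|//]] i] [[|[|//]] j];
  by rewrite /= /cart_adj /= /path_adj /= ?andbF ?andbT ?orbF.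
Qed.

Lemma neighbors_prism S (i : 'I_2) v : v \in S ->
  neighbors (prism S) (i, v) =
  (rev_ord i, v) |: [set (i, u) | u in neighbors S v].
Proof.
move=> Sv; apply/setP => -[j u]; rewrite !(in_setX, inE) adj_prism xpair_eqE.
have -> : ((j, u) \in [set (i, u) | u in neighbors S v]) =
          (i == j) && (u \in neighbors S v).
  apply/imsetP/andP => [[x nx [-> ->]]|[/eqP<- nu]]; first by rewrite eqxx.
  by exists u.
rewrite inE.
have -> : (j == rev_ord i) = (i != j).
  by case: i j => [[|[|//]] i] [[|[|//]] j].
case: (i == j) => //=; rewrite orbF eq_sym.
by case: eqVneq => [->|]; rewrite ?Sv ?andbF.
Qed.

Lemma prismD1 S (i : 'I_2) v :
  prism S :\ (i, v) :\ (rev_ord i, v) = prism (S :\ v).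
Proof.
apply/setP => -[j u]; rewrite !(in_setX, inE) !xpair_eqE.
by case: i j => [[|[|//]] i] [[|[|//]] j]; rewrite /= ?andbT.
Qed.

Definition num_prism_matchings S : nat := num_perfect_matchings_on (prism S).

Lemma num_prism_matchings0 : num_prism_matchings set0 = 1.
Proof.
rewrite -(num_perfect_matchings_on0 G); congr num_perfect_matchings_on.
by apply/setP => -[i u]; rewrite in_setX !inE.
Qed.

Lemma num_prism_matchingsT :
  num_prism_matchings setT = num_perfect_matchings G.
Proof.
rewrite -num_perfect_matchings_onT; congr num_perfect_matchings_on.
by apply/setP => -[i u]; rewrite in_setX !inE.
Qed.

Lemma num_prism_matchings_isolated S v :
  v \in S -> neighbors S v = set0 ->
  num_prism_matchings S = num_prism_matchings (S :\ v).
Proof.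
move=> Sv nbrv; rewrite /num_prism_matchings -(prismD1 S ord0).
apply: num_perfect_matchings_on_deg1; first by rewrite in_setX inE.
by rewrite neighbors_prism // nbrv imset0 setU0.
Qed.

Lemma num_prism_matchings_leaf S v w :
  v \in S -> neighbors S v = [set w] ->
  num_prism_matchings S =
  num_prism_matchings (S :\ v) + num_prism_matchings (S :\ v :\ w).
Proof.
move=> Sv nbrv; pose i : 'I_2 := ord0; pose j := rev_ord i.
have /adj_neq neq_vw : adj v w.
  by have := set11 w; rewrite -nbrv inE => /andP[].
have nbr_prism k : neighbors (prism S) (k, v) = [set (rev_ord k, v); (k, w)].
  by rewrite neighbors_prism // nbrv imset_set1.
rewrite /num_prism_matchings -(prismD1 S i).
rewrite (num_perfect_matchings_on_deg2 _ _ (nbr_prism i)) ?in_setX ?inE //.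
congr (_ + _); rewrite (@num_perfect_matchings_on_deg1 G _ (j, v) (j, w)).
- rewrite -(prismD1 _ i) -(prismD1 S i); congr num_perfect_matchings_on.
  by apply/setP => x; rewrite !in_setD1; congr (_ && _); rewrite andbCA.
- by rewrite in_setD1 in_setD1 in_setX inE !xpair_eqE.
- rewrite !neighborsD1 nbr_prism rev_ordK setU1K; last first.
    by rewrite inE xpair_eqE (negPf neq_vw) andbF.
  by apply/setP => x; rewrite !inE andb_idl // => /eqP->; rewrite xpair_eqE.
Qed.

End Prism.

Section PrismOfSmallGraphs.
Variable H : sgraph.
Implicit Types u v w : H.

Lemma num_prism_matchings_set1 v : num_prism_matchings [set v] = 1.
Proof.
rewrite (num_prism_matchings_isolated (set11 v)).
  by rewrite setDv num_prism_matchings0.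
by rewrite neighbors_set1 adj_irrefl.
Qed.

Lemma num_prism_matchings_nonedge v w :
  v != w -> ~~ adj v w -> num_prism_matchings [set v; w] = 1.
Proof.
move=> neq_vw /negPf nadj_vw.
rewrite (num_prism_matchings_isolated (set21 v w)).
  by rewrite setU1K ?inE // num_prism_matchings_set1.
by rewrite neighborsU1 neighbors_set1 adj_irrefl nadj_vw.
Qed.

Lemma num_prism_matchings_edge v w :
  adj v w -> num_prism_matchings [set v; w] = 2.
Proof.
move=> vw; rewrite (@num_prism_matchings_leaf _ _ v w) ?set21 //.
  rewrite setU1K ?inE ?adj_neq // setDv.
  by rewrite num_prism_matchings_set1 num_prism_matchings0.
by rewrite neighborsU1 neighbors_set1 adj_irrefl vw.
Qed.

Lemma num_prism_matchings_path3 u v w :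
  adj u v -> adj v w -> u != w -> ~~ adj u w ->
  num_prism_matchings [set u; v; w] = 3.
Proof.
move=> uv vw neq_uw /negPf nadj_uw; rewrite -setUA.
rewrite (@num_prism_matchings_leaf _ _ u v) ?setU11 //.
  rewrite !setU1K ?inE ?negb_or ?neq_uw ?(adj_neq uv) ?(adj_neq vw) //.
  by rewrite num_prism_matchings_edge // num_prism_matchings_set1.
by rewrite !neighborsU1 neighbors_set1 adj_irrefl uv nadj_uw setU0.
Qed.

End PrismOfSmallGraphs.

Section Caterpillar.
Variable n : nat.

Definition initial k : {set caterpillar n} := [set i : 'I_n | i < k].

Lemma initial_full : initial n = setT.
Proof. by apply/setP => i; rewrite !inE ltn_ord. Qed.

Lemma initialD1 k (i : 'I_n) :
  i = k :> nat -> initial k.+1 :\ (i : caterpillar n) = initial k.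
Proof.
move=> i_k; apply/setP => j; rewrite !inE -(inj_eq val_inj) /= i_k ltnS.
by rewrite [RHS]ltn_neqAle.
Qed.

Lemma neighbors_initial k (i j : 'I_n) :
  2 <= k -> i = k.+1 :> nat -> j = k :> nat ->
  neighbors (initial k.+2) i = [set (j : caterpillar n)].
Proof.
move=> k_ge2 i_k j_k; apply/setP => x; rewrite !inE -(inj_eq val_inj) /=.
rewrite /caterpillar_adj /caterpillar_edge i_k j_k; lia.
Qed.

Lemma num_prism_matchings_initial_rec k : 2 <= k -> k.+2 <= n ->
  num_prism_matchings (initial k.+2) =
  num_prism_matchings (initial k.+1) + num_prism_matchings (initial k).
Proof.
move=> k_ge2 lt_k1n; pose i : caterpillar n := Ordinal lt_k1n.
pose j : caterpillar n := Ordinal (ltnW lt_k1n).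
have nbr_i : neighbors (initial k.+2) i = [set j] by exact: neighbors_initial.
by rewrite (num_prism_matchings_leaf _ nbr_i) ?inE // !initialD1.
Qed.

End Caterpillar.

Section CaterpillarPrism.
Variable m : nat.

Let v1 : caterpillar m.+3 := ord0.
Let v2 : caterpillar m.+3 := Ordinal (isT : 1 < m.+3).
Let v3 : caterpillar m.+3 := Ordinal (isT : 2 < m.+3).

Lemma num_prism_matchings_initial2 : num_prism_matchings (initial m.+3 2) = 1.
Proof.
have -> : initial m.+3 2 = [set v1; v2].
  by apply/setP => -[[|[|i]] lt_i]; rewrite !inE -!(inj_eq val_inj).
exact: num_prism_matchings_nonedge.
Qed.

Lemma num_prism_matchings_initial3 : num_prism_matchings (initial m.+3 3) = 3.
Proof.
have -> : initial m.+3 3 = [set v1; v3; v2].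
  by apply/setP => -[[|[|[|i]]] lt_i]; rewrite !inE -!(inj_eq val_inj).
exact: num_prism_matchings_path3.
Qed.

Lemma num_prism_matchings_initial k : k < m.+2 ->
  num_prism_matchings (initial m.+3 k.+2) = lucas k.+1.
Proof.
elim/ltn_ind: k => -[|[|k]] IH lt_km.
- exact: num_prism_matchings_initial2.
- exact: num_prism_matchings_initial3.
by rewrite num_prism_matchings_initial_rec // !IH // ltnW // ltnW.
Qed.

End CaterpillarPrism.

Theorem theorem5p9 (n : nat) (hn : 3 <= n) :
  lucas (n - 1) = num_perfect_matchings (cart_prod (path_graph 2) (caterpillar n)).
Proof.
rewrite -num_prism_matchingsT -initial_full.
by case: n hn => [|[|[|m]]] // _; rewrite num_prism_matchings_initial // subn1.
Qed.
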